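(* Let $D$ be a radicable division ring with infinite center $F$, and let $n$ be a positive integer. (1) Let $k$ be a positive integer. For all $\lambda,\mu\in F\setminus\{0\}$ and every $A\in\mathrm{M}_n(D)$ there exist $B,C\in\mathrm{M}_n(D)$ such that $A=\lambda B^k+\mu C^k$. (2) For every integer $m\ge 2$, all positive integers $k_1,\dots,k_m$ and all $\lambda_1,\dots,\lambda_m\in F\setminus\{0\}$, the map $$\mathrm{M}_n(D)^m\to\mathrm{M}_n(D),\qquad (A_1,\dots,A_m)\mapsto \lambda_1A_1^{k_1}+\lambda_2A_2^{k_2}+\cdots+\lambda_mA_m^{k_m}$$ induced by the diagonal polynomial $\lambda_1x_1^{k_1}+\cdots+\lambda_mx_m^{k_m}$ is surjective.
   Context: A division ring $D$ (commutative or not) is radicable if for every $a\in D$ and every positive integer $k$ the equation $x^k-a=0$ has a solution in $D$. $\mathrm{M}_n(D)$ is the ring of $n\times n$ matrices over $D$. *)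

(* Defs.v *)
From mathcomp Require Import all_boot all_algebra.
From mathcomp Require Import boolp classical_sets functions cardinality.
Set Implicit Arguments.
Unset Strict Implicit.
Unset Printing Implicit Defensive.
Import GRing.Theory.
Local Open Scope classical_set_scope.
Local Open Scope ring_scope.

(* [GRing.field_axiom R] says that every nonzero element of [R] is a unit; it
   does not include commutativity, which MathComp adds separately in
   [fieldType]. *)
Definition division_ring (R : unitRingType) : Prop := GRing.field_axiom R.

Definition ring_center (R : unitRingType) : set R :=
  [set z | forall x : R, GRing.comm z x].
Arguments ring_center R : clear implicits.

Definition radicable (R : unitRingType) : Prop :=
  forall (a : R) (k : nat), (0 < k)%N -> exists x : R, x ^+ k - a = 0.

(* Powers are taken in the matrix ring. Over a noncommutative [R] the scaling
   [c *: A] multiplies the entries of [A] by [c] on the left; for central [c]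
   the side does not matter. *)
Definition diagonal_map (R : unitRingType) (n m : nat)
    (lam : 'I_m -> R) (k : 'I_m -> nat)
    (A : {ffun 'I_m -> 'M[R]_n}) : 'M[R]_n :=
  \sum_(i < m) lam i *: A i ^+ k i.

(* Main.v *)
(** Choose [L] lower and [U] upper triangular with [A = L + U]. A triangular
    matrix whose diagonal entries are distinct, and central except possibly the
    last one, is diagonalizable, hence is [lam] times a [k]-th power because [D]
    is radicable. Up to similarity all the diagonal entries of [A] but the last
    are central; they split as [c + (a - c)] with [c] central, and since the
    center is infinite [c] can be chosen so that the entries of [L], and those
    of [U], are distinct. *)

Require Import Defs.
From mathcomp Require Import all_boot all_algebra.
From mathcomp Require Import boolp classical_sets functions cardinality.
Set Implicit Arguments.
Unset Strict Implicit.
Unset Printing Implicit Defensive.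
Import GRing.Theory.
Local Open Scope classical_set_scope.
Local Open Scope ring_scope.

(** Over an arbitrary ring a one-sided inverse of a matrix need not be two-sided, so both identities
    are demanded. *)
Definition mx_similar (D : unitRingType) (n : nat) (A B : 'M[D]_n) : Prop :=
  exists P Q : 'M[D]_n,
    [/\ P *m Q = 1%:M, Q *m P = 1%:M & B = P *m A *m Q].

Definition scaled_power (D : unitRingType) (lam : D) (k n : nat)
    (M : 'M[D]_n) : Prop :=
  exists B : 'M[D]_n, M = lam *: B ^+ k.

(** * Powers, conjugation and block triangular matrices over a general ring *)

Section UnitRing.
Variable D : unitRingType.
Implicit Types (s lam : D) (m n p k : nat).

Lemma central_scalemxAr s m n p (A : 'M[D]_(m, n)) (B : 'M[D]_(n, p)) :
  ring_center D s -> A *m (s *: B) = s *: (A *m B).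
Proof.
move=> sZ; apply/matrixP=> i j; rewrite !mxE big_distrr /=.
by apply: eq_bigr => l _; rewrite !mxE !mulrA (sZ (A i l)).
Qed.

Lemma central_mul_mx_scalar s m n (A : 'M[D]_(m, n)) :
  ring_center D s -> A *m s%:M = s *: A.
Proof. by move=> sZ; rewrite -scalemx1 central_scalemxAr// mulmx1. Qed.

Lemma exprmxS n (A : 'M[D]_n) k : A ^+ k.+1 = A *m A ^+ k.
Proof. by rewrite exprS. Qed.

(** The inner factors [P *m Q] cancel. For [k = 0] the right side would be [Q *m P], which the
    hypothesis does not make the identity. *)
Lemma expr_conjmx n (P Q B : 'M[D]_n) k :
  P *m Q = 1%:M -> (0 < k)%N -> (Q *m B *m P) ^+ k = Q *m B ^+ k *m P.
Proof.
move=> PQ; case: k => // k _; elim: k => [|k IHk]; first by rewrite !expr1.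
rewrite exprmxS IHk [B ^+ k.+2]exprmxS !mulmxA; congr (_ *m _ *m _).
by rewrite -mulmxA PQ mulmx1.
Qed.

Lemma expr_block_diag m n (A : 'M[D]_m) (B : 'M[D]_n) k :
  (block_mx A 0 0 B : 'M_(m + n)) ^+ k = block_mx (A ^+ k) 0 0 (B ^+ k).
Proof.
elim: k => [|k IHk]; first by rewrite !expr0 -scalar_mx_block.
by rewrite !exprmxS IHk mulmx_block !mul0mx !mulmx0 !addr0 !add0r.
Qed.

Lemma mx_similar_trans n (A B C : 'M[D]_n) :
  mx_similar A B -> mx_similar B C -> mx_similar A C.
Proof.
case=> P [Q] [PQ QP ->] [P'] [Q'] [PQ' QP' ->].
exists (P' *m P), (Q *m Q'); split; last by rewrite !mulmxA.
- by rewrite -mulmxA (mulmxA P) PQ mul1mx.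
- by rewrite -mulmxA (mulmxA Q') QP' mul1mx.
Qed.

Lemma lower_unipotentM m n (x y : 'M[D]_(n, m)) :
  block_mx 1%:M 0 x 1%:M *m block_mx 1%:M 0 y 1%:M
  = block_mx 1%:M 0 (x + y) 1%:M :> 'M_(m + n).
Proof.
by rewrite mulmx_block !(mul1mx, mulmx1, mul0mx, mulmx0, addr0, add0r).
Qed.

Lemma upper_unipotentM m n (x y : 'M[D]_(m, n)) :
  block_mx 1%:M x 0 1%:M *m block_mx 1%:M y 0 1%:M
  = block_mx 1%:M (y + x) 0 1%:M :> 'M_(m + n).
Proof.
by rewrite mulmx_block !(mul1mx, mulmx1, mul0mx, mulmx0, addr0, add0r).
Qed.

Lemma similar_lower_unipotent m n (x : 'M[D]_(n, m)) (A : 'M_(m + n)) :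
  mx_similar A (block_mx 1%:M 0 x 1%:M *m A *m block_mx 1%:M 0 (- x) 1%:M).
Proof.
exists (block_mx 1%:M 0 x 1%:M), (block_mx 1%:M 0 (- x) 1%:M).
by rewrite !lower_unipotentM subrr addNr -scalar_mx_block.
Qed.

Lemma similar_upper_unipotent m n (x : 'M[D]_(m, n)) (A : 'M_(m + n)) :
  mx_similar A (block_mx 1%:M x 0 1%:M *m A *m block_mx 1%:M (- x) 0 1%:M).
Proof.
exists (block_mx 1%:M x 0 1%:M), (block_mx 1%:M (- x) 0 1%:M).
by rewrite !upper_unipotentM subrr addNr -scalar_mx_block.
Qed.

Lemma scaled_power_conj lam k n (P Q M : 'M[D]_n) :
    ring_center D lam -> (0 < k)%N -> P *m Q = 1%:M ->
  scaled_power lam k M -> scaled_power lam k (Q *m M *m P).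
Proof.
move=> lamZ k_gt0 PQ [B ->]; exists (Q *m B *m P).
by rewrite expr_conjmx// central_scalemxAr// -scalemxAl.
Qed.

Lemma scaled_power_similar lam k n (M N : 'M[D]_n) :
    ring_center D lam -> (0 < k)%N -> mx_similar M N ->
  scaled_power lam k M -> scaled_power lam k N.
Proof.
by move=> lamZ k_gt0 [P] [Q] [_ QP ->]; apply: scaled_power_conj.
Qed.

Lemma scaled_power_block_diag lam k m n (M : 'M[D]_m) (N : 'M[D]_n) :
    scaled_power lam k M -> scaled_power lam k N ->
  scaled_power lam k (block_mx M 0 0 N : 'M_(m + n)).
Proof.
case=> B -> [C ->]; exists (block_mx B 0 0 C).
by rewrite expr_block_diag scale_block_mx !scaler0.
Qed.

(* The hypothesis on [N] makes the Sylvester equation [L y - y c = x] solvable,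
   so that the block matrix is similar to [diag(c, L)]. *)
Lemma scaled_power_block_lower lam k c m n (x : 'M[D]_(n, m)) (L N : 'M[D]_n) :
    ring_center D lam -> (0 < k)%N -> ring_center D c ->
    (L - c%:M) *m N = 1%:M ->
    scaled_power lam k (c%:M : 'M_m) -> scaled_power lam k L ->
  scaled_power lam k (block_mx c%:M 0 x L : 'M_(m + n)).
Proof.
move=> lamZ k_gt0 cZ LN cP LP.
(* With [y = - N x] the lower left block of the conjugate is [y c - L y = (L - c) N x = x]. *)
have := similar_lower_unipotent (- (N *m x)) (block_mx c%:M 0 0 L : 'M_(m + n)).
move=> /(scaled_power_similar lamZ k_gt0)/(_ (scaled_power_block_diag cP LP)).
rewrite !mulmx_block !(mul1mx, mulmx1, mul0mx, mulmx0, addr0, add0r) opprK.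
by rewrite mulNmx central_mul_mx_scalar// -mul_scalar_mx addrC -mulmxBl mulmxA
  LN mul1mx.
Qed.

(** Here the equation is [y U - c y = x], with solution [y = x N]; the unknown stands on the left of
    [U], so [N] is a left inverse. *)
Lemma scaled_power_block_upper lam k c m n (x : 'M[D]_(m, n)) (U N : 'M[D]_n) :
    ring_center D lam -> (0 < k)%N -> ring_center D c ->
    N *m (U - c%:M) = 1%:M ->
    scaled_power lam k (c%:M : 'M_m) -> scaled_power lam k U ->
  scaled_power lam k (block_mx c%:M x 0 U : 'M_(m + n)).
Proof.
move=> lamZ k_gt0 cZ NU cP UP.
have := similar_upper_unipotent (x *m N) (block_mx c%:M 0 0 U : 'M_(m + n)).
move=> /(scaled_power_similar lamZ k_gt0)/(_ (scaled_power_block_diag cP UP)).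
rewrite !mulmx_block !(mul1mx, mulmx1, mul0mx, mulmx0, addr0, add0r).
by rewrite mulmxN mul_scalar_mx -central_mul_mx_scalar// addrC -mulmxBr -mulmxA
  NU mulmx1.
Qed.

(** In the induction on the size, this carries the invertibility of [L - s] from the trailing block
    to the whole triangular matrix. *)
Lemma block_lower_right_inverse m n (A A' : 'M[D]_m) (x : 'M[D]_(n, m))
    (L L' : 'M[D]_n) :
    A *m A' = 1%:M -> L *m L' = 1%:M ->
  block_mx A 0 x L *m block_mx A' 0 (- (L' *m x *m A')) L'
  = 1%:M :> 'M_(m + n).
Proof.
move=> AA' LL'; rewrite mulmx_block !(mul0mx, mulmx0, addr0, add0r) AA' LL'.
by rewrite mulmxN !mulmxA LL' mul1mx subrr -scalar_mx_block.
Qed.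

Lemma block_upper_left_inverse m n (A A' : 'M[D]_m) (x : 'M[D]_(m, n))
    (U U' : 'M[D]_n) :
    A' *m A = 1%:M -> U' *m U = 1%:M ->
  block_mx A' (- (A' *m x *m U')) 0 U' *m block_mx A x 0 U
  = 1%:M :> 'M_(m + n).
Proof.
move=> AA' UU'; rewrite mulmx_block !(mul0mx, mulmx0, addr0, add0r) AA' UU'.
by rewrite mulNmx -!mulmxA UU' mulmx1 subrr -scalar_mx_block.
Qed.

Lemma central_exists_notin (s : seq D) :
  infinite_set (ring_center D) -> exists2 c, ring_center D c & c \notin s.
Proof.
move=> infD; apply: contrapT => nex; apply: infD.
apply: (sub_finite_set _ (finite_seq s)) => c cZ /=.
by apply: contrapT => cs; apply: nex; exists c => //; apply/negP.
Qed.

End UnitRing.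

(** * Similarity over a division ring: making the corner entry central *)

Section DivisionRing.
Variable D : unitRingType.
Hypothesis D_division : division_ring D.
Implicit Types (n : nat) (a : D).

Lemma row_mul_surj n (c : 'cV[D]_n) (b : 'M[D]_1) :
  c != 0 -> exists r : 'rV[D]_n, r *m c = b.
Proof.
move=> /matrix0Pn[i [j]]; rewrite ord1 => ci.
exists ((b 0 0 * (c i 0)^-1) *: delta_mx 0 i).
rewrite -scalemxAl -rowE; apply/matrixP => u v; rewrite !ord1 !mxE.
by rewrite -mulrA mulVr ?mulr1//; apply: D_division.
Qed.

Lemma col_mul_surj n (r : 'rV[D]_n) (b : 'M[D]_1) :
  r != 0 -> exists c : 'cV[D]_n, r *m c = b.
Proof.
move=> /matrix0Pn[i [j]]; rewrite ord1 => rj.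
exists (delta_mx j 0 *m (((r 0 j)^-1 * b 0 0)%:M : 'M_1)).
rewrite mulmxA -colE; apply/matrixP => u v; rewrite !ord1 !mxE big_ord1 !mxE.
by rewrite mulr1n mulrA mulrV ?mul1r//; apply: D_division.
Qed.

(** Conjugating by [[[1, r], [0, 1]]] adds [r c] to the corner, [c] being the column below it; a
    nonzero [c] allows [r c] to cancel the corner. *)
Lemma similar_corner0_of_col n (A : 'M[D]_(1 + n)) :
  dlsubmx A != 0 -> exists2 B, mx_similar A B & ulsubmx B = 0.
Proof.
move=> /row_mul_surj-/(_ (- ulsubmx A))[r rc].
exists (block_mx 1%:M r 0 1%:M *m A *m block_mx 1%:M (- r) 0 1%:M).
  exact: similar_upper_unipotent.
rewrite -[A]submxK !mulmx_block block_mxKul.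
by rewrite !(mul1mx, mulmx1, mul0mx, mulmx0, addr0, add0r) rc subrr.
Qed.

Lemma similar_corner0_of_row n (A : 'M[D]_(1 + n)) :
  ursubmx A != 0 -> exists2 B, mx_similar A B & ulsubmx B = 0.
Proof.
move=> /col_mul_surj-/(_ (ulsubmx A))[c rc].
exists (block_mx 1%:M 0 c 1%:M *m A *m block_mx 1%:M 0 (- c) 1%:M).
  exact: similar_lower_unipotent.
rewrite -[A]submxK !mulmx_block block_mxKul.
by rewrite !(mul1mx, mulmx1, mul0mx, mulmx0, addr0, add0r) mulmxN rc subrr.
Qed.

(* When [A = diag(a, A')], either some [x] has [x a != A' x], and conjugating by
   [[1, 0], [x, 1]] creates a nonzero entry below [a], or [A'] is the scalar
   matrix [a] with [a] central. *)
Lemma similar_central_corner n (A : 'M[D]_(1 + n.+1)) :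
  exists2 B, mx_similar A B &
    exists2 a, ring_center D a & ulsubmx B = a%:M.
Proof.
have Z0 : ring_center D 0 by move=> x; rewrite /GRing.comm mul0r mulr0.
have corner0 A1 : mx_similar A A1 ->
    (exists2 B, mx_similar A1 B & ulsubmx B = 0) ->
    exists2 B, mx_similar A B & exists2 a, ring_center D a & ulsubmx B = a%:M.
  move=> AA1 [B A1B B0]; exists B; first exact: mx_similar_trans A1B.
  by exists 0 => //; rewrite B0 raddf0.
have AA : mx_similar A A by exists 1%:M, 1%:M; rewrite !mul1mx mulmx1.
have [c0|/similar_corner0_of_col] := eqVneq (dlsubmx A) 0; last exact: corner0.
have [r0|/similar_corner0_of_row] := eqVneq (ursubmx A) 0; last exact: corner0.
have [[x xP]|nex] :=
    pselect (exists x, x *m ulsubmx A - drsubmx A *m x != 0).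
  apply: corner0 (similar_lower_unipotent x A) _.
  apply: similar_corner0_of_col; rewrite -[A]submxK !mulmx_block block_mxKdl.
  by rewrite c0 !(mul1mx, mulmx1, addr0) mulmxN r0 mulmx0 add0r.
have comm x : x *m ulsubmx A = drsubmx A *m x.
  by apply/subr0_eq/eqP; apply: contrapT => /negP xP; apply: nex; exists x.
exists A => //; exists (ulsubmx A 0 0); last exact: mx11_scalar.
(* The trailing block [A'] is nonempty, so [x = e_0 t] and [x = e_0] may be taken:
   [e_0 t a = A' e_0 t = e_0 a t], whose first coordinate says that [a] commutes with [t]. *)
move=> t; have := comm (delta_mx 0 0 *m (t%:M : 'M_1)).
have := comm (delta_mx 0 0); rewrite mulmxA => <-.
rewrite -!mulmxA => /(congr1 (row 0)); rewrite !row_mul.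
rewrite (_ : row 0 (delta_mx 0 0) = 1%:M); last first.
  by apply/matrixP => u v; rewrite !ord1 !mxE.
rewrite !mul1mx [ulsubmx A]mx11_scalar -!scalar_mxM => /matrixP/(_ 0 0).
by rewrite !mxE /GRing.comm !mulr1n.
Qed.

Lemma scalar_mx_inverse n a : a != 0 ->
  (a%:M : 'M[D]_n) *m a^-1%:M = 1%:M /\ (a^-1%:M : 'M_n) *m a%:M = 1%:M.
Proof. by move=> /D_division aU; rewrite -!scalar_mxM mulrV ?mulVr. Qed.

(** * Triangular decomposition into two scaled powers *)

Hypothesis D_radicable : radicable D.

Lemma scaled_power_scalar lam k n a :
  lam != 0 -> (0 < k)%N -> scaled_power lam k (a%:M : 'M[D]_n).
Proof.
move=> /D_division lamU /(D_radicable (lam^-1 * a))[x /subr0_eq xk].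
exists x%:M; rewrite (_ : x%:M ^+ k = (x ^+ k)%:M); last first.
  elim: k {xk} => [//|k IHk].
  by rewrite exprmxS IHk -scalar_mxM -exprS.
by rewrite xk scale_scalar_mx mulrA mulrV ?mul1r.
Qed.

Hypothesis F_infinite : infinite_set (ring_center D).

(* The avoided central elements [S] are the diagonal entries already used, kept
   out of the spectra of the two summands for the induction on the size. *)
Lemma sum_scaled_powers_avoiding lam mu k l n (A : 'M[D]_n) (S : seq D) :
    ring_center D lam -> lam != 0 -> ring_center D mu -> mu != 0 ->
    (0 < k)%N -> (0 < l)%N -> (0 < n)%N -> {in S, forall s, ring_center D s} ->
  exists L U : 'M[D]_n,
    [/\ A = L + U, scaled_power lam k L, scaled_power mu l U,
        {in S, forall s, exists N, (L - s%:M) *m N = 1%:M} &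
        {in S, forall s, exists N, N *m (U - s%:M) = 1%:M}].
Proof.
move=> lamZ lam0 muZ mu0 k_gt0 l_gt0.
(* Only finitely many [c] are excluded: those in [T] and those of the form [a - s] with [s] in
   [T]. *)
have split_entry (a : D) (T : seq D) : exists c,
    [/\ ring_center D c, {in T, forall s, c - s != 0}
      & {in T, forall s, a - c - s != 0}].
  have [c cZ] := central_exists_notin (T ++ [seq a - s | s <- T]) F_infinite.
  rewrite mem_cat negb_or => /andP[cT caT]; exists c; split => // s sT.
    by rewrite subr_eq0; apply: contraNneq cT => ->.
  apply: contraNneq caT => acs; apply/mapP; exists s => //.
  by rewrite -(subr0_eq acs) opprB addrC subrK.
case: n A => // n A _; elim: n A S => [|n IHn] A S SZ.
  (* In size 1 the entry may be noncentral; radicability still makes [c] and [A 0 0 - c] scaled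
     powers. *)
  have [c [cZ cS acS]] := split_entry (A 0 0) S.
  exists c%:M, (A 0 0 - c)%:M; split; try exact: scaled_power_scalar.
  - by rewrite -raddfD /= addrC subrK; apply: mx11_scalar.
  - move=> s /cS /(scalar_mx_inverse 1)[cN _].
    by exists (c - s)^-1%:M; rewrite -raddfB.
  - move=> s /acS /(scalar_mx_inverse 1)[_ cN].
    by exists (A 0 0 - c - s)^-1%:M; rewrite -raddfB.
have [B [P [Q [PQ QP BE]]] [a aZ Ba]] :=
  similar_central_corner (A : 'M_(1 + n.+1)).
have [c [cZ cS acS]] := split_entry a S.
have acZ : ring_center D (a - c).
  by move=> x; rewrite /GRing.comm mulrBl mulrBr aZ cZ.
(* Adding [c] and [a - c] to the avoided list makes [L' - c] and [U' - (a - c)] invertible on the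
   side that the block lemmas require. *)
have [|L' [U' [B'E L'P U'P L'S U'S]]] := IHn (drsubmx B) [:: c, a - c & S].
  by move=> s; rewrite !inE => /or3P[/eqP->|/eqP->|/SZ].
pose L : 'M_(1 + n.+1) := block_mx c%:M 0 (dlsubmx B) L'.
pose U : 'M_(1 + n.+1) := block_mx (a - c)%:M (ursubmx B) 0 U'.
have subl s : L - s%:M = block_mx (c - s)%:M 0 (dlsubmx B) (L' - s%:M).
  by rewrite scalar_mx_block opp_block_mx add_block_mx !subr0 -raddfB.
have subu s : U - s%:M = block_mx (a - c - s)%:M (ursubmx B) 0 (U' - s%:M).
  by rewrite scalar_mx_block opp_block_mx add_block_mx !subr0 -raddfB.
(* Conjugation fixes central scalar matrices, so avoiding [s] can be checked before returning from
   [B] to [A]. *)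
have conjB s (M : 'M_(1 + n.+1)) : ring_center D s ->
    Q *m M *m P - s%:M = Q *m (M - s%:M) *m P.
  move=> sZ; rewrite mulmxBr mulmxBl central_mul_mx_scalar//.
  by rewrite -scalemxAl QP scalemx1.
have conj1 (M N : 'M_(1 + n.+1)) : M *m N = 1%:M ->
    (Q *m M *m P) *m (Q *m N *m P) = 1%:M.
  move=> MN; rewrite !mulmxA -(mulmxA (Q *m M)) PQ mulmx1 -(mulmxA Q) MN.
  by rewrite mulmx1 QP.
(* Since [B = P A Q] and [B = L + U], conjugating back gives [A = Q L P + Q U P]. *)
exists (Q *m L *m P), (Q *m U *m P); split.
- rewrite -mulmxDl -mulmxDr add_block_mx -raddfD /= addr0 add0r -B'E.
  rewrite (addrC c) subrK -Ba submxK BE !mulmxA QP mul1mx -mulmxA.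
  by rewrite QP mulmx1.
- apply: scaled_power_conj => //.
  have [|N LN] := L'S c; first by rewrite !inE eqxx.
  apply: (@scaled_power_block_lower D lam k c 1 n.+1 _ L' N) => //.
  exact: scaled_power_scalar.
- apply: scaled_power_conj => //.
  have [|N UN] := U'S (a - c); first by rewrite !inE eqxx orbT.
  apply: (@scaled_power_block_upper D mu l (a - c) 1 n.+1 _ U' N) => //.
  exact: scaled_power_scalar.
- move=> s sS; have [|N LN] := L'S s; first by rewrite !inE sS !orbT.
  have [cN _] := scalar_mx_inverse 1 (cS _ sS).
  eexists; rewrite conjB; last exact: SZ.
  by apply: conj1; rewrite subl; apply: block_lower_right_inverse cN LN.
- move=> s sS; have [|N UN] := U'S s; first by rewrite !inE sS !orbT.
  have [_ cN] := scalar_mx_inverse 1 (acS _ sS).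
  eexists; rewrite conjB; last exact: SZ.
  by apply: conj1; rewrite subu; apply: block_upper_left_inverse cN UN.
Qed.

(** Nothing has to be avoided at the outermost level. The exponents may differ, as the diagonal map
    requires. *)
Lemma sum_scaled_powers lam mu k l n (A : 'M[D]_n) :
    ring_center D lam -> lam != 0 -> ring_center D mu -> mu != 0 ->
    (0 < k)%N -> (0 < l)%N -> (0 < n)%N ->
  exists B C : 'M[D]_n, A = lam *: B ^+ k + mu *: C ^+ l.
Proof.
move=> lamZ lam0 muZ mu0 k_gt0 l_gt0 n_gt0.
have [] := @sum_scaled_powers_avoiding lam mu k l n A [::] => //.
by move=> _ [_ [-> [B ->] [C ->] _ _]]; exists B, C.
Qed.

End DivisionRing.

Theorem theorem4p2 (D : unitRingType) (n : nat)
    (D_division : division_ring D) (D_radicable : radicable D)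
    (F_infinite : infinite_set (ring_center D)) (n_gt0 : (0 < n)%N) :
  (forall k : nat, (0 < k)%N ->
     forall lam mu : D,
       ring_center D lam -> lam != 0 -> ring_center D mu -> mu != 0 ->
     forall A : 'M[D]_n, exists B C : 'M[D]_n,
       A = lam *: B ^+ k + mu *: C ^+ k)
  /\
  (forall m : nat, (2 <= m)%N ->
     forall k : 'I_m -> nat, (forall i, (0 < k i)%N) ->
     forall lam : 'I_m -> D,
       (forall i, ring_center D (lam i) /\ lam i != 0) ->
     set_surj [set: {ffun 'I_m -> 'M[D]_n}] [set: 'M[D]_n]
       (@diagonal_map D n m lam k)).
Proof.
split=> [k k_gt0 lam mu lamZ lam0 muZ mu0 A|m m_ge2 k k_gt0 lam lamP A _].
  exact: sum_scaled_powers.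
case: m m_ge2 k k_gt0 lam lamP => [|[|m]]// _ k k_gt0 lam lamP.
have [lamZ lam0] := lamP ord0; have [muZ mu0] := lamP (lift ord0 ord0).
have [B [C ->]] := sum_scaled_powers D_division D_radicable F_infinite A
  lamZ lam0 muZ mu0 (k_gt0 ord0) (k_gt0 (lift ord0 ord0)) n_gt0.
(* The first two variables already reach the target; the others are set to 0, and their powers
   vanish because the exponents are positive. *)
exists [ffun i : 'I_m.+2 =>
  if i == ord0 then B else if i == lift ord0 ord0 then C else 0] => //.
rewrite /diagonal_map big_ord_recl big_ord_recl big1 => [|i _].
  by rewrite !ffunE /= addr0.
by rewrite ffunE /= expr0n gtn_eqF ?k_gt0//= scaler0.
Qed.
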